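(* Let $M \in \mathbb{R}^{n\times n}$, $q \in \mathbb{R}^n$, $T \in \mathbb{R}^{n\times k}$, and let $\mathcal{U} \subset \mathbb{R}^k$ be convex and compact with $0 \in \operatorname{relint}(\mathcal{U})$. Let $\mathcal{B} = \{v^1,\dots,v^\ell\}$, $\ell \le k$, be a basis of the linear hull $\operatorname{lin}(\mathcal{U})$ of $\mathcal{U}$. Let $D \in \mathbb{R}^{n\times k}$ and $r \in \mathbb{R}^n$ be such that $z(u) = Du + r$ satisfies $z(u) \ge 0$ and $Mz(u) + q + Tu \ge 0$ for all $u \in \mathcal{U}$, and define $I = \{ i \in \{1,\dots,n\} : r_i > 0 \}$. Then $z(u) = Du + r$ is an affinely adjustable robust (AAR) solution if and only if $D$ and $r$ satisfy $$M_{I,\cdot}\, r + q_I = 0 \qquad\text{and}\qquad (M_{I,\cdot} D + T_{I,\cdot})\, v^j = 0 \quad \text{for all } j \in \{1,\dots,\ell\}.$$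
   Context: Vector inequalities are componentwise. For $a,b\in\mathbb{R}^n$, $0 \le a \perp b \ge 0$ means $a \ge 0$, $b \ge 0$ and $a^\top b = 0$. The affinely adjustable robust linear complementarity problem for $(q,M,T,\mathcal{U})$ consists of finding $D \in \mathbb{R}^{n\times k}$ and $r\in\mathbb{R}^n$ such that $z(u) = Du + r$ satisfies $$0 \le z(u) \perp Mz(u) + q + Tu \ge 0 \quad\text{for all } u \in \mathcal{U};$$ such a $z(u) = Du + r$ is called an AAR solution. Notation: for an index set $I$, $A_{I,\cdot}$ is the submatrix of $A$ consisting of the rows indexed by $I$ (all columns), and $b_I$ is the subvector of $b$ with entries indexed by $I$. $\operatorname{relint}$ denotes the relative interior, and $\operatorname{lin}(\mathcal{U})$ is the linear span of $\mathcal{U}$. *)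

(* Defs.v *)
From mathcomp Require Import all_boot all_order all_algebra.
From mathcomp Require Import all_classical all_reals all_analysis.
Set Implicit Arguments.
Unset Strict Implicit.
Unset Printing Implicit Defensive.
Import Order.TTheory GRing.Theory Num.Theory.
Import numFieldNormedType.Exports.
Local Open Scope classical_set_scope.
Local Open Scope ring_scope.

Definition lev (R : realType) (n : nat) (a b : 'cV[R]_n) : Prop :=
  forall i, a i 0 <= b i 0.

(* 0 <= a _|_ b >= 0; the 1 x 1 matrix a^T *m b is the scalar a^T b. *)
Definition complementary (R : realType) (n : nat) (a b : 'cV[R]_n) : Prop :=
  [/\ lev 0 a, lev 0 b & a^T *m b = 0].

Definition affine_rule (R : realType) (n k : nat)
    (D : 'M[R]_(n, k)) (r : 'cV[R]_n) (u : 'cV[R]_k) : 'cV[R]_n :=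
  D *m u + r.

Definition AAR_solution (R : realType) (n k : nat)
    (q : 'cV[R]_n) (M : 'M[R]_n) (T : 'M[R]_(n, k)) (U : set 'cV[R]_k)
    (D : 'M[R]_(n, k)) (r : 'cV[R]_n) : Prop :=
  forall u, U u ->
    complementary (affine_rule D r u) (M *m affine_rule D r u + q + T *m u).

(* A_{I,.}: enum_val lists the elements of I in increasing order.
   For p = 1 this is the subvector b_I. *)
Definition subrows (R : realType) (n p : nat) (I : {set 'I_n})
    (A : 'M[R]_(n, p)) : 'M[R]_(#|I|, p) :=
  rowsub (@enum_val _ (mem I)) A.

Definition lin_hull (R : realType) (V : lmodType R) (U : set V) : set V :=
  [set x | exists m (c : 'I_m -> R) (y : 'I_m -> V),
    (forall i, U (y i)) /\ x = \sum_i c i *: y i].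

Definition aff_hull (R : realType) (V : lmodType R) (U : set V) : set V :=
  [set x | exists m (c : 'I_m -> R) (y : 'I_m -> V),
    [/\ forall i, U (y i), \sum_i c i = 1 & x = \sum_i c i *: y i]].

(* The interior of U for the topology induced on its affine hull.  [subspace A]
   keeps the carrier and makes the points outside A isolated; this adds nothing
   here because U is contained in its affine hull: see relintE. *)
Definition relint (R : realType) (k : nat) (U : set 'cV[R]_k) : set 'cV[R]_k :=
  @interior (subspace (aff_hull U)) U.

Lemma sub_aff_hull (R : realType) (V : lmodType R) (U : set V) :
  U `<=` aff_hull U.
Proof.
move=> x Ux; exists 1%N, (fun=> 1), (fun=> x).
by split => //; rewrite big_ord1 // scale1r.
Qed.

Lemma relintE (R : realType) (k : nat) (U : set 'cV[R]_k) :
  relint U = [set x | aff_hull U x /\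
    exists2 e, 0 < e & ball x e `&` aff_hull U `<=` U].
Proof.
have withinE x : aff_hull U x -> relint U x = within (aff_hull U) (nbhs x) U.
  by move=> Ax; rewrite nbhs_subspace_in.
apply/seteqP; split=> x.
- move=> xU; have Ax : aff_hull U x.
    exact: sub_aff_hull (@interior_subset (subspace (aff_hull U)) U x xU).
  split=> //; move: xU; rewrite withinE// => /nbhs_ballP[e /= e0 eU].
  by exists e => // y [xy Ay]; exact: eU.
- move=> [Ax [e e0 eU]]; rewrite withinE//.
  by apply/nbhs_ballP; exists e => // y xy Ay; apply: eU.
Qed.

Definition basis_of_set (R : realType) (k l : nat)
    (v : l.-tuple 'cV[R]_k) (L : set 'cV[R]_k) : Prop :=
  free v /\ [set x | x \in <<v>>%VS] = L.

(* Main.v *)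
(* As 0 is a relative interior point of U, every x in lin(U) satisfies t x, -t x
   in U for some t > 0; hence a linear form that is nonnegative on U vanishes on
   lin(U).  So a component of z(u) or of w(u) = M z(u) + q + T u that is 0 at
   u = 0 is 0 on all of U.  This applies to z_i if r_i = 0, and to w_i if
   r_i > 0, where complementarity at u = 0 forces w_i(0) = 0. *)
Require Import Defs.
From mathcomp Require Import all_boot all_order all_algebra.
From mathcomp Require Import all_classical all_reals all_analysis.
Set Implicit Arguments.
Unset Strict Implicit.
Unset Printing Implicit Defensive.
Import Order.TTheory GRing.Theory Num.Theory.
Import numFieldNormedType.Exports.
Local Open Scope classical_set_scope.
Local Open Scope ring_scope.

(** The point 0 of [U], added at index [ord0], absorbs the missing weight [1 - \sum_j c j]: the
    weights then sum to 1 and the combination is unchanged. *)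
Lemma lin_hull_sub_aff_hull (R : realType) (V : lmodType R) (U : set V) :
  U 0 -> lin_hull U `<=` aff_hull U.
Proof.
move=> U0 x [m [c [y [Uy ->]]]].
exists m.+1, (fun i => oapp c (1 - \sum_j c j) (unlift ord0 i)),
  (fun i => oapp y 0 (unlift ord0 i)); split.
- by move=> i; case: unliftP => [j _|_] /=.
- rewrite big_ord_recl unlift_none /=.
  by rewrite [X in _ + X](eq_bigr c) ?subrK// => i _; rewrite liftK.
- rewrite big_ord_recl unlift_none /= scaler0 add0r.
  by apply: eq_bigr => i _; rewrite liftK.
Qed.

Lemma lin_hullZ (R : realType) (V : lmodType R) (U : set V) (a : R) (x : V) :
  lin_hull U x -> lin_hull U (a *: x).
Proof.
move=> [m [c [y [Uy ->]]]]; exists m, (fun i => a * c i), y; split=> //.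
by rewrite scaler_sumr; apply: eq_bigr => i _; rewrite scalerA.
Qed.

Lemma sub_lin_hull (R : realType) (V : lmodType R) (U : set V) :
  U `<=` lin_hull U.
Proof.
move=> x Ux; exists 1%N, (fun=> 1), (fun=> x).
by split => //; rewrite big_ord1 scale1r.
Qed.

Lemma relint_sub (R : realType) (k : nat) (U : set 'cV[R]_k) :
  relint U `<=` U.
Proof. exact: (@interior_subset (subspace (aff_hull U))). Qed.

Lemma relint0_absorbing (R : realType) (k : nat) (U : set 'cV[R]_k)
    (x : 'cV[R]_k) :
  relint U 0 -> lin_hull U x -> exists2 t : R, 0 < t & U (t *: x).
Proof.
move=> U0r Lx; have U0 := relint_sub U0r.
move: U0r; rewrite relintE => -[_ [e e0 eU]].
have x1 : 0 < `|x| + 1 by rewrite ltr_wpDl.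
(* The added 1 covers [x = 0] and makes the norm of the scaled vector strictly less than [e]. *)
exists (e / (`|x| + 1)); first exact: divr_gt0.
apply: eU; split; last exact/(lin_hull_sub_aff_hull U0)/lin_hullZ.
rewrite -ball_normE /= sub0r normrN normrZ gtr0_norm ?divr_gt0//.
by rewrite mulrAC ltr_pdivrMr// ltr_pM2l// ltrDl.
Qed.

Lemma ge0_row_eq0 (R : realType) (m k : nat) (U : set 'cV[R]_k)
    (A : 'M[R]_(m, k)) (i : 'I_m) :
  relint U 0 -> (forall u, U u -> 0 <= (A *m u) i 0) ->
  forall x, lin_hull U x -> (A *m x) i 0 = 0.
Proof.
move=> U0 A_ge0.
have lin_ge0 x : lin_hull U x -> 0 <= (A *m x) i 0.
  move=> /(relint0_absorbing U0)[t t0 /A_ge0].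
  by rewrite -scalemxAr mxE pmulr_rge0.
move=> x Lx; apply/eqP; rewrite eq_le lin_ge0// andbT.
(* The linear hull also contains [- x], which gives the reverse inequality. *)
by have := lin_ge0 _ (lin_hullZ (-1) Lx); rewrite scaleN1r mulmxN mxE oppr_ge0.
Qed.

(** A sum of nonnegative terms vanishes only if each term does. *)
Lemma complementaryP (R : realType) (n : nat) (a b : 'cV[R]_n) :
  complementary a b <->
  [/\ lev 0 a, lev 0 b & forall i, a i 0 * b i 0 = 0].
Proof.
split=> -[a0 b0 ab]; split=> //.
  move=> i; apply/eqP; have /matrixP/(_ 0 0) := ab; rewrite !mxE => /eqP.
  rewrite psumr_eq0; first by move=> /allP/(_ i (mem_index_enum i)); rewrite mxE.
  move=> j _; rewrite mxE mulr_ge0//.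
    by have := a0 j; rewrite mxE.
  by have := b0 j; rewrite mxE.
apply/matrixP => i j; rewrite !ord1 !mxE big1// => h _.
by rewrite mxE ab.
Qed.

Lemma subrowsM (R : realType) (n p h : nat) (I : {set 'I_n}) (A : 'M[R]_(n, p))
    (B : 'M[R]_(p, h)) :
  subrows I A *m B = subrows I (A *m B).
Proof. by rewrite /subrows mul_rowsub_mx. Qed.

Lemma subrowsD (R : realType) (n p : nat) (I : {set 'I_n}) (A B : 'M[R]_(n, p)) :
  subrows I A + subrows I B = subrows I (A + B).
Proof. by apply/matrixP => i j; rewrite !mxE. Qed.

Lemma subrows_eq0P (R : realType) (n : nat) (I : {set 'I_n}) (b : 'cV[R]_n) :
  subrows I b = 0 <-> forall i, i \in I -> b i 0 = 0.
Proof.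
split=> [b0 i iI|b0].
  by move/matrixP: b0 => /(_ (enum_rank_in iI i) 0); rewrite !mxE enum_rankK_in.
by apply/matrixP => i j; rewrite !mxE ord1 b0// enum_valP.
Qed.

Theorem theorem1 (R : realType) (n k : nat)
  (M : 'M[R]_n) (q : 'cV[R]_n) (T : 'M[R]_(n, k)) (U : set 'cV[R]_k)
  (U_convex : convex_set U) (U_compact : compact U) (U_relint : relint U 0)
  (l : nat) (le_lk : (l <= k)%N) (v : l.-tuple 'cV[R]_k)
  (v_basis : basis_of_set v (lin_hull U))
  (D : 'M[R]_(n, k)) (r : 'cV[R]_n)
  (z_ge0 : forall u, U u -> lev 0 (affine_rule D r u))
  (w_ge0 : forall u, U u ->
     lev 0 (M *m affine_rule D r u + q + T *m u)) :
  let I := [set i : 'I_n | 0 < r i 0]%SET in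
  AAR_solution q M T U D r <->
  (subrows I M *m r + subrows I q = 0 /\
   forall j : 'I_l, (subrows I M *m D + subrows I T) *m tnth v j = 0).
Proof.
move=> I; case: v_basis => _ v_span.
have U0 : U 0 := relint_sub U_relint.
set N := M *m D + T; set s := M *m r + q.
(* Separates the linear part of w(u) from its value [s] at 0; the two conditions of the theorem
   concern the rows in [I] of [s] and [N]. *)
have wE u : M *m affine_rule D r u + q + T *m u = N *m u + s.
  rewrite /affine_rule mulmxDr mulmxA [N *m u]mulmxDl -!addrA.
  by congr (_ + _); rewrite addrA addrC.
rewrite !subrowsM !subrowsD -/N -/s.
have r_ge0 i : 0 <= r i 0.
  by have := z_ge0 _ U0 i; rewrite /affine_rule mulmx0 add0r mxE.
split=> [sol|[/subrows_eq0P s0 Nv]].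
(* Complementarity at [u = 0] reads [r i 0 * s i 0 = 0]. *)
- have s0 i : i \in I -> s i 0 = 0.
    rewrite inE => ri; have /complementaryP[_ _ /(_ i)] := sol _ U0.
    rewrite wE /affine_rule !mulmx0 !add0r => /eqP.
    by rewrite mulf_eq0 gt_eqF//= => /eqP.
  split=> [|j]; first exact/subrows_eq0P.
  rewrite subrowsM; apply/subrows_eq0P => i iI.
  (* Since [s i 0 = 0], row [i] of [N *m u] is w_i(u), hence nonnegative on [U]. *)
  apply: (ge0_row_eq0 U_relint) => [u Uu|].
    by have := w_ge0 _ Uu i; rewrite wE [X in _ <= X]mxE s0// addr0 mxE.
  by rewrite -v_span /=; apply/memv_span/mem_tnth.
- move=> u Uu; have Lu := sub_lin_hull Uu.
  apply/complementaryP; split; [exact: z_ge0|exact: w_ge0|move=> i].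
  have [iI|] := boolP (i \in I).
    (* For [i] in [I], w_i(u) = 0: the rows of [N] in [I] vanish on the basis, hence at [u], which
       lies in its span. *)
    suff Nu : subrows I N *m u = 0.
      move: Nu; rewrite subrowsM wE => /subrows_eq0P/(_ i iI) Nu.
      by rewrite [X in _ * X]mxE Nu s0// addr0 mulr0.
    move: Lu; rewrite -v_span /= => /coord_span->.
    rewrite mulmx_sumr big1// => j _.
    by rewrite -scalemxAr -tnth_nth Nv scaler0.
  rewrite inE -leNgt => ri.
  (* Outside [I], z_i(u) is the linear form [(D *m u) i 0], nonnegative on [U] and therefore zero
     there. *)
  have r0 : r i 0 = 0 by apply/eqP; rewrite eq_le ri r_ge0.
  rewrite /affine_rule [X in X * _]mxE r0 addr0 (ge0_row_eq0 U_relint) ?mul0r//.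
  by move=> u' /z_ge0/(_ i); rewrite /affine_rule [X in _ <= X]mxE r0 addr0 mxE.
Qed.
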